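(* Let $C,D\subseteq\mathbb{R}^n$ be convex sets and $S\subseteq C\cap D$ non-empty. Beginning with $T_0=\mathbb{R}^n$, let $$T_{i+1}=T_i\cap\big(N_C^{T_i}(S)\cap[-N_D^{T_i}(S)]\big)^\perp .$$ Let $\ell$ be the first index for which $T_{\ell+1}=T_\ell$. Then: 1. $T_\ell=T(C,D)$, the joint supporting subspace of $C$ and $D$. 2. $\ell\le n$.
   Context: $A\pm B=\{a\pm b\mid a\in A,b\in B\}$; $K^\perp$ is the orthogonal complement of a set $K$ in $\mathbb{R}^n$. Nested normal cone: for $C\subseteq\mathbb{R}^n$ convex, $S\subseteq C$ non-empty, and a linear subspace $U\subseteq\mathbb{R}^n$ with $S-S\subseteq U$, $$N_C^U(S):=\{v\in U\mid \forall c\in C\cap(U+S),\ \forall s\in S,\ \langle c-s,v\rangle\le 0\}.$$ Faces: a subset $F\subseteq C$ of a convex set is a face of $C$ if for all $y,z\in C$, whenever the open segment $]y,z[ = [y,z]\setminus\{y,z\}$ meets $F$, both $y,z\in F$. For $S\subseteq C$, $F_C(S)$ denotes the smallest face of $C$ containing $S$; $F_C(x)=F_C(\{x\})$. The joint supporting subspace of convex $C,D\subseteq\mathbb{R}^n$ (with $C\cap D\ne\emptyset$) is $T(C,D):=\operatorname{Span}F_{C-D}(0)$ (linear span). *)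

(* Defs.v *)
From HB Require Import structures.
From mathcomp Require Import all_boot all_order all_algebra.
From mathcomp Require Import interval_inference boolp classical_sets reals convex.

Set Implicit Arguments.
Unset Strict Implicit.
Unset Printing Implicit Defensive.

Import Order.TTheory GRing.Theory Num.Theory.
Local Open Scope classical_set_scope.
Local Open Scope convex_scope.
Local Open Scope ring_scope.

Section JointSupportingSubspace.
Context {R : realType} {n : nat}.
Implicit Types (A C D F K S U : set 'rV[R]_n) (u v y z : 'rV[R]_n).

Definition dotv u v : R := \sum_(i < n) u 0 i * v 0 i.

Definition set_add A C : set 'rV[R]_n := [set a + c | a in A & c in C].
Definition set_sub A C : set 'rV[R]_n := [set a - c | a in A & c in C].
Definition set_opp A : set 'rV[R]_n := [set - a | a in A].

Definition orth K : set 'rV[R]_n := [set x | forall k, K k -> dotv x k = 0].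

Definition segment y z : set 'rV[R]_n :=
  range (fun t : {i01 R} => (y : convex_lmodType 'rV[R]_n) <| t |> z).

(* Empty when y = z, unlike the image of the open unit interval. *)
Definition open_segment y z : set 'rV[R]_n := segment y z `\` [set y; z].

(* Faces may be empty and are not assumed to be convex. *)
Definition is_face C F : Prop :=
  F `<=` C /\
  forall y z, C y -> C z -> open_segment y z `&` F !=set0 -> F y /\ F z.

(* Meaningful for S `<=` C: an intersection of faces of C is a face of C. *)
Definition face C S : set 'rV[R]_n := smallest (is_face C) S.

Definition lin_span A : set 'rV[R]_n :=
  smallest (fun E : set 'rV[R]_n => submod_closed [in E]) A.

(* Meant for U a linear subspace with S - S included in U and S included in C. *)
Definition nested_normal_cone C U S : set 'rV[R]_n :=
  [set v | U v /\ forall c s, (C `&` set_add U S) c -> S s ->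
                              dotv (c - s) v <= 0].

Definition joint_supporting_subspace C D : set 'rV[R]_n :=
  lin_span (face (set_sub C D) [set 0]).

Fixpoint Tseq C D S (i : nat) : set 'rV[R]_n :=
  if i is j.+1 then
    let T := Tseq C D S j in
    T `&` orth (nested_normal_cone C T S `&` set_opp (nested_normal_cone D T S))
  else setT.

End JointSupportingSubspace.

(* Main.v *)
Require Import Defs.
From mathcomp Require Import all_boot all_order all_algebra.
From mathcomp Require Import boolp classical_sets reals convex.
From mathcomp Require Import interval_inference ring lra.

Set Implicit Arguments.
Unset Strict Implicit.
Unset Printing Implicit Defensive.

Import Order.TTheory GRing.Theory Num.Theory.
Local Open Scope classical_set_scope.
Local Open Scope ring_scope.

(** Write [E] for the difference set [C - D], which is convex and contains [0],
    [K] for the convex cone that [E] generates and [L] for the lineality space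
    of [K], that is, [K] intersected with [- K].

    The smallest face of [E] containing [0] consists of the points of [E] whose
    opposite direction is also available in [E], so it is the intersection of
    [E] with [L], and its linear span is [L] ([span_face_origin]). It remains
    to compare [L] with the sequence [T_i].

    [L] is contained in every [T_i] ([joint_supporting_sub_Tseq]). If [x] is in
    [L], both [t x] and [- t x] are differences [c - d] and [c' - d'] for some
    [t > 0]; the midpoint of [c] and [c'] is also that of [d] and [d'], hence
    lies in both [C] and [D]. Consequently [c], [c'], [d], [d'] differ from
    this midpoint, and from any point of [S], by elements of [L]. By induction
    they lie in [T_i + S], so a vector [v] of the nested normal cone of [C]
    whose opposite is in that of [D] satisfies both [<x, v> <= 0] and [<- x, v> <= 0].

    Conversely, if [T_(i+1) = T_i], the only vector [v] of this kind is [0],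
    as it is in [T_i] and orthogonal to itself. But a
    convex cone strictly contained in a linear subspace has a nonzero supporting
    functional in this subspace ([cone_support_in]). Applied to the cone
    generated by the differences of points of [C] and [D] in [T_i + S], this
    shows that this cone is all of [T_i]; so [T_i] is contained in [K], and in
    [L] by symmetry ([Tseq_fixed]).

    The bound on the first stationary index holds since each strict inclusion
    lowers the dimension ([Tseq_rank]). *)

(** * Scalar product, linear subspaces and orthogonality *)

Section Dot.
Context {R : realType} {n : nat}.
Implicit Types (u v w x : 'rV[R]_n) (U K : set 'rV[R]_n).

Lemma dotvE u v : dotv u v = (u *m v^T) 0 0.
Proof. by rewrite mxE; apply: eq_bigr => i _; rewrite mxE. Qed.

Lemma dotvC u v : dotv u v = dotv v u.
Proof. by apply: eq_bigr => i _; rewrite mulrC. Qed.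

Lemma dotvDl u v w : dotv (u + v) w = dotv u w + dotv v w.
Proof. by rewrite !dotvE mulmxDl mxE. Qed.

Lemma dotvZl a u w : dotv (a *: u) w = a * dotv u w.
Proof. by rewrite !dotvE -scalemxAl mxE. Qed.

Lemma dotvNl u w : dotv (- u) w = - dotv u w.
Proof. by rewrite -scaleN1r dotvZl mulN1r. Qed.

Lemma dotvBl u v w : dotv (u - v) w = dotv u w - dotv v w.
Proof. by rewrite dotvDl dotvNl. Qed.

Lemma dotvv_eq0 u : dotv u u = 0 -> u = 0.
Proof.
move=> /eqP; rewrite psumr_eq0 => [/allP uu0|i _]; last by rewrite -expr2 sqr_ge0.
apply/rowP => i; rewrite mxE; apply/eqP.
by have := uu0 i (mem_index_enum i); rewrite mulf_eq0 orbb.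
Qed.

Lemma submod_closedP U : submod_closed [in U] <->
  U 0 /\ forall a u v, U u -> U v -> U (a *: u + v).
Proof.
split=> [[/set_mem U0 lin]|[U0 lin]].
  by split=> // a u v /mem_set uU /mem_set vU; apply/set_mem/lin.
by split=> [|a u v /set_mem uU /set_mem vU]; apply/mem_set; [|apply: lin].
Qed.

Lemma submodD U u v : submod_closed [in U] -> U u -> U v -> U (u + v).
Proof. by case/submod_closedP=> _ lin uU vU; rewrite -[u]scale1r; apply: lin. Qed.

Lemma submodZ U a u : submod_closed [in U] -> U u -> U (a *: u).
Proof. by case/submod_closedP=> U0 lin uU; rewrite -[_ *: _]addr0; apply: lin. Qed.

Lemma submodN U u : submod_closed [in U] -> U u -> U (- u).
Proof. by rewrite -scaleN1r; apply: submodZ. Qed.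

Lemma submodB U u v : submod_closed [in U] -> U u -> U v -> U (u - v).
Proof. by move=> Usub uU vU; apply: submodD => //; apply: submodN. Qed.

Lemma orth_submod K : submod_closed [in orth K].
Proof.
apply/submod_closedP; split=> [k _|a u v uK vK k kK].
  by rewrite -(scale0r 0) dotvZl mul0r.
by rewrite dotvDl dotvZl uK// vK// mulr0 addr0.
Qed.

Lemma setI_submod U V : submod_closed [in U] -> submod_closed [in V] ->
  submod_closed [in U `&` V].
Proof.
move=> /submod_closedP[U0 Ulin] /submod_closedP[V0 Vlin].
apply/submod_closedP; split=> // a u v [uU uV] [vU vV].
by split; [apply: Ulin|apply: Vlin].
Qed.

(** Row spaces give access to ranks, hence to a dimension for subspaces that are
    only known as sets: a matrix of maximal rank among those whose row space
    lies in [U] must span [U]. *)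
Lemma submod_row_space U : submod_closed [in U] ->
  exists A : 'M[R]_n, forall u, U u <-> (u <= A)%MS.
Proof.
move=> Usub; have [U0 _] := (submod_closedP U).1 Usub.
pose P r := `[< exists A : 'M[R]_n,
  \rank A = r /\ forall u, (u <= A)%MS -> U u >].
have P0 : exists r, P r.
  exists 0%N; apply/asboolP; exists 0; split; first exact: mxrank0.
  by move=> u /submx0null ->.
have Pn r : P r -> (r <= n)%N by move=> /asboolP[A [<- _]]; apply: rank_leq_col.
case: (ex_maxnP P0 Pn) => r /asboolP[A [rA AU]] rmax.
exists A => u; split=> [uU|]; last exact: AU.
apply: contraT => uA.
suff : (\rank A < r)%N by rewrite rA ltnn.
apply: (@leq_trans (\rank (A + u)%MS)).
  apply: rank_ltmx; rewrite ltmxE addsmxSl/=.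
  by apply: contra uA; apply: submx_trans; apply: addsmxSr.
apply: rmax; apply/asboolP; exists (A + u)%MS; split=> // w.
move=> /sub_addsmxP[[a b] /= ->]; apply: submodD => //.
  by apply: AU; apply: submxMl.
by have /sub_rVP[c ->] := submxMl b u; apply: submodZ.
Qed.

(** The columns of the cokernel of [A] are orthogonal to its row space, and one
    of them is not orthogonal to [x]; it provides [v], up to scaling. *)
Lemma row_space_dual (A : 'M[R]_n) x : ~~ (x <= A)%MS ->
  exists2 v, (forall u, (u <= A)%MS -> dotv u v = 0) & 0 < dotv x v.
Proof.
rewrite submxE => /rV0Pn[j xj].
pose w := (col j (cokermx A))^T.
have wE u : dotv u w = (u *m cokermx A) 0 j.
  by rewrite mxE; apply: eq_bigr => i _; rewrite !mxE.
(* The factor dotv x w makes the value at x a nonzero square. *)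
exists (dotv x w *: w) => [u|]; rewrite (dotvC _ (_ *: w)) dotvZl (dotvC w).
  by rewrite submxE => /eqP uA; rewrite (wE u) uA mxE mulr0.
by rewrite -expr2 wE lt_def sqr_ge0 sqrf_eq0 xj.
Qed.

Lemma orth_orth U : submod_closed [in U] -> orth (orth U) `<=` U.
Proof.
move=> /submod_row_space[A UA] w wU; apply/UA; apply: contraT => /row_space_dual.
case=> v vA; rewrite wU ?ltxx// => u /UA uA.
by rewrite dotvC vA.
Qed.
End Dot.

(** * Supporting hyperplanes of convex cones *)

Section Cone.
Context {R : realType} {n : nat}.
Implicit Types (u v w x : 'rV[R]_n) (U K E : set 'rV[R]_n).

Definition convex_cone K := [/\ K 0, forall x y, K x -> K y -> K (x + y)
  & forall a x, 0 < a -> K x -> K (a *: x)].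

(** The sum [K + U], for a linear subspace [U]; adding [u] instead of subtracting
    it is harmless since [U] is symmetric. *)
Definition add_space K U : set 'rV[R]_n := [set x | exists2 u, U u & K (x + u)].

Definition line z : set 'rV[R]_n := range (fun b : R => b *: z).

Lemma line_submod z : submod_closed [in line z].
Proof.
apply/submod_closedP; split; first by exists 0; rewrite ?scale0r.
by move=> a _ _ [b _ <-] [c _ <-]; exists (a * b + c); rewrite // scalerDl scalerA.
Qed.

Lemma add_space_cone K U : submod_closed [in U] -> convex_cone K ->
  convex_cone (add_space K U).
Proof.
move=> Usub [K0 KD KZ]; have [U0 _] := (submod_closedP U).1 Usub.
split=> [|x y [u uU xK] [v vU yK]|a x a0 [u uU xK]].
- by exists 0; rewrite ?addr0.
- by exists (u + v); [apply: submodD|rewrite addrACA; apply: KD].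
- by exists (a *: u); [apply: submodZ|rewrite -scalerDr; apply: KZ].
Qed.

Lemma sub_add_spacel K U : submod_closed [in U] -> K `<=` add_space K U.
Proof. by move=> /submod_closedP[U0 _] x xK; exists 0; rewrite ?addr0. Qed.

Lemma sub_add_spacer K U : submod_closed [in U] -> convex_cone K ->
  U `<=` add_space K U.
Proof.
move=> Usub [K0 _ _] u uU; exists (- u); first exact: submodN.
by rewrite subrr.
Qed.

(** When [y] is not a multiple of [x], the vector [z] is nonzero, so that a proper
    convex cone in dimension at least two stays proper after adding some line,
    whose direction is in the span of [x] and [y]. If the line through [x] does not work, the
    set of [t] such that [y + t x] lies in [K] is nonempty and bounded above;
    at its supremum, [y + t x] is on the boundary of [K], and the line through
    that point still leaves [x] outside. *)
Lemma exists_line K x y : convex_cone K -> ~ K x ->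
  exists2 z, z = x \/ (exists a, z = a *: x + y)
    & exists w, ~ add_space K (line z) w.
Proof.
move=> Kcone xK; have [K0 KD KZ] := Kcone.
have posx t : K (t *: x) -> t <= 0.
  move=> txK; rewrite leNgt; apply/negP => t0; apply: xK.
  by rewrite -[x](@scalerK _ _ t) ?gt_eqF//; apply: KZ; rewrite ?invr_gt0.
have [yx|yx] := pselect (add_space K (line x) y); last first.
  by exists x; [left|exists y].
have [nyx|nyx] := pselect (add_space K (line x) (- y)); last first.
  by exists x; [left|exists (- y)].
move: yx nyx => [_ [t0 _ <-] yt0] [_ [s0 _ <-] ys0].
pose A := [set t | K (y + t *: x)].
have Aub : ubound A (- s0).
  move=> t tA; suff : t + s0 <= 0 by lra.
  apply: posx; have := KD _ _ tA ys0; congr (K _).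
  by apply/rowP => j; rewrite !mxE; ring.
have supA : has_sup A by split; [exists t0|exists (- s0)].
have Ale t : A t -> t <= sup A by apply: ub_le_sup; exists (- s0).
exists (sup A *: x + y); first by right; exists (sup A).
exists x => -[_ [b _ <-]]; have [b0|b0|->] := ltgtP b 0.
- move=> xbK; have b0' : 0 < (- b)^-1 by rewrite invr_gt0 oppr_gt0.
  have [t tA tlt] := sup_adherent b0' supA.
  suff : (- b)^-1 + t - sup A <= 0 by lra.
  apply: posx; have := KD _ _ (KZ _ _ b0' xbK) tA; congr (K _).
  by apply/rowP => j; rewrite !mxE; field; rewrite lt_eqF.
- move=> xbK; have b0' : 0 < b^-1 by rewrite invr_gt0.
  suff /Ale : A (sup A + b^-1) by lra.
  have := KZ _ _ b0' xbK; congr (K _).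
  by apply/rowP => j; rewrite !mxE; field; rewrite gt_eqF.
- by rewrite scale0r addr0.
Qed.

(** The cone is not assumed to be closed, so no nearest point argument applies.
    Instead, [K] is enlarged by lines while it stays proper: the induction
    keeps a subspace [M] (the row space of a matrix) inside [K] and ends when
    [M] is a hyperplane. Then [K] cannot meet the open side of [M] that
    contains [x], since it would contain [x], and the normal of [M] pointing to
    that side supports [K]. *)
Lemma cone_support K x : convex_cone K -> ~ K x ->
  exists2 v, v != 0 & forall k, K k -> dotv k v <= 0.
Proof.
pose M : 'M[R]_n := 0.
have : forall u, (u <= M)%MS -> convex_cone K -> K u.
  by move=> u /submx0null -> [].
have [m] := ubnP (n - \rank M)%N; move: M.
elim: m K x => // m IH K x M; rewrite ltnS => rM MK Kcone xK.
have {}MK u : (u <= M)%MS -> K u by move=> /MK; apply.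
have [K0 KD KZ] := Kcone.
have xM : ~~ (x <= M)%MS by apply/negP => /MK.
(* If M and x span everything, then M is a hyperplane. *)
have [full|] := pselect (forall y : 'rV[R]_n, (y <= M + x)%MS).
  have [v Mv xv] := row_space_dual xM.
  exists v.
    apply: contraTneq xv => ->.
    by rewrite dotvC -(scale0r 0) dotvZl mul0r ltxx.
  move=> k kK; have /sub_addsmxP[[a b] /= kE] := full k.
  have /sub_rVP[c cE] := submxMl b x.
  rewrite kE cE dotvDl Mv ?submxMl// add0r dotvZl.
  rewrite pmulr_lle0// leNgt; apply/negP => c0; apply: xK.
  rewrite -[x](@scalerK _ _ c) ?gt_eqF//; apply: KZ; first by rewrite invr_gt0.
  rewrite -cE -[b *m x](addKr (a *m M)) -kE addrC; apply: KD => //.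
  by apply: MK; rewrite -mulNmx submxMl.
move=> /existsNP[y /negP yMx].
have [z zE [w wK]] := exists_line y Kcone xK.
have zM : ~~ (z <= M)%MS.
  case: zE => [->//|[a zE]]; apply: contra yMx => zM.
  have -> : y = z - a *: x by rewrite zE addrAC subrr add0r.
  rewrite addmx_sub//; first exact: submx_trans zM (addsmxSl _ _).
  by rewrite eqmx_opp scalemx_sub// addsmxSr.
have [|u uMz _|//|//|v v0 Kv] := IH (add_space K (line z)) w (M + z)%MS.
- have : (\rank M < \rank (M + z)%MS)%N.
    apply: rank_ltmx; rewrite ltmxE addsmxSl/=.
    by apply: contra zM; apply: submx_trans; apply: addsmxSr.
  move=> rMz; apply: leq_trans rM; apply: ltn_sub2l => //.
  by apply: leq_trans rMz (rank_leq_col _).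
- move: uMz => /sub_addsmxP[[c d] /= ->].
  have [_ LD _] := add_space_cone (line_submod z) Kcone.
  apply: LD; first by apply: sub_add_spacel (line_submod z) _ (MK _ (submxMl _ _)).
  have /sub_rVP[e ->] := submxMl d z.
  by apply: (sub_add_spacer (line_submod z) Kcone); exists e.
- exact: add_space_cone (line_submod z) Kcone.
- by exists v => // k kK; apply: Kv; apply: sub_add_spacel (line_submod z) _ kK.
Qed.

(** Adding [orth U] to [K] turns the relative statement into the absolute one:
    the sum is still proper because [U] meets [orth U] only in [0], and a
    functional that is nonpositive on it vanishes on [orth U], hence lies in
    [U]. *)
Lemma cone_support_in U K x : submod_closed [in U] -> convex_cone K ->
  K `<=` U -> U x -> ~ K x ->
  exists v, [/\ v <> 0, U v & forall k, K k -> dotv k v <= 0].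
Proof.
move=> Usub Kcone KU xU xK; have osub := @orth_submod R n U.
have xK' : ~ add_space K (orth U) x.
  move=> [w wU xwK].
  have wU' : U w.
    rewrite -(addKr x w); apply: submodD => //; first exact: submodN.
    exact: KU.
  have := dotvv_eq0 (wU w wU') => w0.
  by apply: xK; move: xwK; rewrite w0 addr0.
have [v /eqP v0 vK] := cone_support (add_space_cone osub Kcone) xK'.
exists v; split=> // [|k kK]; last by apply: vK; apply: sub_add_spacel.
apply: (orth_orth Usub) => w wU; rewrite dotvC; apply: le_anti.
apply/andP; split; first by apply: vK; apply: sub_add_spacer.
rewrite -oppr_le0 -dotvNl; apply: vK; apply: sub_add_spacer => //.
exact: submodN osub wU.
Qed.

(** * The face of the origin and its span *)

(** For a convex [E] containing [0], this is the convex cone generated by [E]. *)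
Definition cone_hull E : set 'rV[R]_n := [set x | exists2 t, 0 < t & E (t *: x)].

Definition lineality K : set 'rV[R]_n := [set x | K x /\ K (- x)].

Lemma convex_setP E a b x y : convex_set E -> E x -> E y ->
  0 <= a -> 0 <= b -> a + b = 1 -> E (a *: x + b *: y).
Proof.
move=> Econv /mem_set xE /mem_set yE a0 b0 ab1.
have a1 : a <= 1 by lra.
have := Econv x y (Itv01 a0 a1) xE yE => /set_mem; congr (E _).
by congr (_ + _ *: _); rewrite /unstable.onem/=; lra.
Qed.

Lemma convex_star E a x : convex_set E -> E 0 -> E x -> 0 <= a -> a <= 1 ->
  E (a *: x).
Proof.
move=> Econv E0 xE a0 a1; rewrite -[_ *: _]addr0 -(scaler0 _ (1 - a)).
by apply: convex_setP => //; lra.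
Qed.

Lemma cone_hull_cone E : convex_set E -> E 0 -> convex_cone (cone_hull E).
Proof.
move=> Econv E0; split=> [|x y [s s0 xE] [t t0 yE]|a x a0 [t t0 xE]].
- by exists 1; rewrite ?scaler0.
- exists (s * t / (s + t)); first by rewrite divr_gt0 ?mulr_gt0 ?addr_gt0.
  have : E (t / (s + t) *: (s *: x) + s / (s + t) *: (t *: y)).
    apply: convex_setP => //; rewrite ?divr_ge0 ?addr_ge0 ?ltW//.
    by field; rewrite gt_eqF// addr_gt0.
  congr (E _); apply/rowP => j; rewrite !mxE; field.
  by rewrite gt_eqF// addr_gt0.
- exists (t / a); first by rewrite divr_gt0.
  by rewrite scalerA divfK ?gt_eqF.
Qed.

Lemma lineality_submod K : convex_cone K -> submod_closed [in lineality K].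
Proof.
move=> [K0 KD KZ]; apply/submod_closedP; split; first by rewrite /lineality/= oppr0.
have LN u : lineality K u -> lineality K (- u) by move=> [? ?]; split; rewrite ?opprK.
have LD u v : lineality K u -> lineality K v -> lineality K (u + v).
  by move=> [? ?] [? ?]; split; rewrite ?opprD; apply: KD.
have LZ c u : 0 < c -> lineality K u -> lineality K (c *: u).
  by move=> c0 [? ?]; split; rewrite -?scalerN; apply: KZ.
move=> a u v uL vL; apply: LD => //.
have [a0|a0|->] := ltgtP a 0; last by rewrite scale0r; split; rewrite ?oppr0.
  by rewrite -[a]opprK scaleNr; apply/LN/LZ; rewrite ?oppr_gt0.
exact: LZ.
Qed.

(** A convex set containing [0] is star-shaped, so one scaling factor serves
    for both directions. *)
Lemma lineality_cone_hullP E x : convex_set E -> E 0 ->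
  lineality (cone_hull E) x -> exists t, [/\ 0 < t, E (t *: x) & E (- (t *: x))].
Proof.
move=> Econv E0 [[s s0 sx] [t t0 tx]]; exists (Num.min s t).
have m0 : 0 < Num.min s t by rewrite lt_min s0.
split=> //.
- rewrite -[Num.min s t](@divfK _ s) ?gt_eqF// -scalerA.
  apply: convex_star => //; first by rewrite divr_ge0 ?ltW.
  by rewrite ler_pdivrMr// mul1r ge_min lexx.
- rewrite -[Num.min s t](@divfK _ t) ?gt_eqF// -scalerA -scalerN -scalerN.
  apply: convex_star => //; first by rewrite divr_ge0 ?ltW.
  by rewrite ler_pdivrMr// mul1r ge_min lexx orbT.
Qed.

(** A face containing [0] contains every nonzero [x] of [E] such that some [- t x] is in
    [E], because [0] lies in the open segment between them. Conversely these
    points form a face: if [- w] is in the cone for some [w] strictly between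
    [y] and [z], then so are [- y] and [- z]. *)
Lemma face_origin E : convex_set E -> E 0 ->
  face E [set 0] = E `&` lineality (cone_hull E).
Proof.
move=> Econv E0; set K := cone_hull E.
have KE x : E x -> K x by move=> xE; exists 1; rewrite ?scale1r.
have Kcone : convex_cone K by apply: cone_hull_cone.
have [K0 KD KZ] := Kcone.
apply/seteqP; split=> [x|x [xE xL]].
  apply; split; last by move=> _ ->; split=> //; split; rewrite ?oppr0.
  split=> [? []//|y z yE zE [w [[[t _ wE] /not_orP[wy wz]] [wEE [Kw Knw]]]]].
  have t0 : 0 < t%:num.
    rewrite lt_def ge0 andbT; apply/eqP => t0; apply: wz.
    by rewrite -wE /conv/= t0 /unstable.onem subr0 scale0r scale1r add0r.
  have t1 : 0 < 1 - t%:num.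
    rewrite lt_def subr_ge0 le1 andbT subr_eq0; apply/eqP => t1; apply: wy.
    by rewrite -wE /conv/= -t1 /unstable.onem subrr scale0r scale1r addr0.
  have wE' : w = t%:num *: y + (1 - t%:num) *: z by rewrite -wE.
  (* -p is a positive multiple of -(a p + b q) + b q. *)
  have aux a b (p q : 'rV[R]_n) : 0 < a -> 0 < b -> E q -> K (- (a *: p + b *: q)) ->
      K (- p).
    move=> a0 b0 /KE qK Ks.
    have a0' : 0 < a^-1 by rewrite invr_gt0.
    have := KZ _ _ a0' (KD _ _ Ks (KZ _ _ b0 qK)); congr (K _).
    by apply/rowP => j; rewrite !mxE; field; rewrite gt_eqF.
  split; split=> //; split; try exact: KE.
    by apply: aux t0 t1 zE _; rewrite -wE'.
  by apply: aux t1 t0 yE _; rewrite addrC -wE'.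
move=> F [[FE Fface] F0].
have [->|x0] := eqVneq x 0; first exact: F0.
have [_ [t t0 tx]] := xL.
have s0 : 0 < t + 1 by rewrite addr_gt0.
have p0 : 0 <= t / (t + 1) by rewrite divr_ge0 ?ltW.
have p1 : t / (t + 1) <= 1 by rewrite ler_pdivrMr// mul1r lerDl.
apply: (Fface x (t *: - x) xE tx _).1.
exists 0; split; last exact: F0.
split.
  exists (Itv01 p0 p1) => //; rewrite /conv/= /unstable.onem.
  by apply/rowP => j; rewrite !mxE; field; rewrite gt_eqF.
by case=> /esym/eqP; rewrite ?scaler_eq0 ?oppr_eq0 ?(negbTE x0) ?(gt_eqF t0).
Qed.

Lemma span_face_origin E : convex_set E -> E 0 ->
  lin_span (face E [set 0]) = lineality (cone_hull E).
Proof.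
move=> Econv E0; rewrite face_origin//; set L := lineality _.
have Lsub : submod_closed [in L] by apply/lineality_submod/cone_hull_cone.
apply/seteqP; split=> [x|x xL U [Usub LU]].
  by apply; split=> // ? [].
have [t [t0 tx _]] := lineality_cone_hullP Econv E0 xL.
rewrite -[x](@scalerK _ _ t) ?gt_eqF//; apply: submodZ => //; apply: LU.
by split=> //; apply: submodZ.
Qed.
End Cone.

(** * The decreasing sequence of subspaces *)

Section Tseq.
Context {R : realType} {n : nat}.
Implicit Types (u v w x : 'rV[R]_n) (C D S T U K E : set 'rV[R]_n).

Lemma convex_set_sub C D : convex_set C -> convex_set D ->
  convex_set (set_sub C D).
Proof.
move=> Cconv Dconv x y t /set_mem[c cC [d dD <-]] /set_mem[c' cC' [d' dD' <-]].
apply/mem_set; exists (t%:num *: c + (1 - t%:num) *: c').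
  by apply: convex_setP; rewrite // ?subr_ge0 ?ge0 ?le1// addrC subrK.
exists (t%:num *: d + (1 - t%:num) *: d').
  by apply: convex_setP; rewrite // ?subr_ge0 ?ge0 ?le1// addrC subrK.
rewrite /conv/= /unstable.onem.
by apply/rowP => j; rewrite !mxE; ring.
Qed.

Lemma Tseq_submod C D S i : submod_closed [in Tseq C D S i].
Proof.
elim: i => [|i IH]; first by apply/submod_closedP.
by apply: setI_submod => //; apply: orth_submod.
Qed.

(** Each strict inclusion lowers the rank by at least one, starting from [n]. *)
Lemma Tseq_rank C D S m : (forall k, (k < m)%N -> Tseq C D S k.+1 <> Tseq C D S k) ->
  exists2 A : 'M[R]_n, (forall u, Tseq C D S m u <-> (u <= A)%MS)
    & (\rank A + m <= n)%N.
Proof.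
elim: m => [|m IH] neq.
  exists 1%:M; first by move=> u; split=> // _; apply: submx1.
  by rewrite addn0 rank_leq_col.
have [|A TA rA] := IH; first by move=> k km; apply: neq; apply: ltnW.
have [B TB] := submod_row_space (Tseq_submod C D S m.+1).
exists B => //; rewrite addnS -addSn; apply: leq_trans rA.
rewrite leq_add2r; apply: rank_ltmx; rewrite ltmxE.
have T_sub : Tseq C D S m.+1 `<=` Tseq C D S m by move=> u [].
apply/andP; split.
  by apply/row_subP => i; apply/TA/T_sub/TB; apply: row_sub.
apply/negP => AB; apply: (neq m (ltnSn m)); apply/seteqP; split=> // u /TA uA.
by apply/TB; apply: submx_trans uA AB.
Qed.

Section Fixed.
Variables C D S : set 'rV[R]_n.
Hypotheses (Cconv : convex_set C) (Dconv : convex_set D).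
Hypotheses (S0 : S !=set0) (SCD : S `<=` C `&` D).

Let E := set_sub C D.
Let L := lineality (cone_hull E).
Let Econv : convex_set E := convex_set_sub Cconv Dconv.

Let E0 : E 0.
Proof.
have [s /SCD[sC sD]] := S0.
by exists s => //; exists s => //; rewrite subrr.
Qed.

Let Lsub : submod_closed [in L].
Proof. exact/lineality_submod/cone_hull_cone. Qed.

Lemma lineality_subI s m : (C `&` D) s -> (C `&` D) m -> L (m - s).
Proof.
by move=> [sC sD] [mC mD]; split; exists 1; rewrite // scale1r ?opprB;
  [exists m|exists s] => //; [exists s|exists m].
Qed.

(** The common midpoint of the pairs [c], [c'] and [d], [d'] is what allows
    the induction to go on: it places these four points in [T_i + S], where the
    inequalities defining the nested normal cones are available. *)
Lemma joint_supporting_sub_Tseq i : L `<=` Tseq C D S i.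
Proof.
elim: i => [|i IH] // x xL; split; first exact: IH.
set T := Tseq C D S i in IH *.
move=> v [[_ vC] [w [_ wD] wv]].
have dotw u : dotv u w = - dotv u v by rewrite -wv ![dotv u _]dotvC dotvNl opprK.
have [s Ss] := S0; have sCD := SCD Ss.
have [t [t0 [c cC [d dD cd]] [c' cC' [d' dD' cd']]]] :=
  lineality_cone_hullP Econv E0 xL.
pose m := (1 / 2) *: c + (1 / 2) *: c'.
have cE : c = t *: x + d by rewrite -cd subrK.
have cE' : c' = - (t *: x) + d' by rewrite -cd' subrK.
have mE : m = (1 / 2) *: d + (1 / 2) *: d'.
  by rewrite /m cE cE'; apply/rowP => j; rewrite !mxE; field.
have mCD : (C `&` D) m.
  by split; [rewrite /m|rewrite mE]; apply: convex_setP => //; lra.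
have LS p : L (p - m) -> set_add T S p.
  move=> pm; exists (p - s); last by exists s => //; rewrite subrK.
  apply: IH; have -> : p - s = (p - m) + (m - s) by rewrite addrA subrK.
  by apply: submodD => //; apply: lineality_subI.
have EK u : E u -> cone_hull E u by exists 1; rewrite ?scale1r.
have Lc : L (c - m).
  split; apply: EK; first by exists c => //; exists m => //; case: mCD.
  exists c' => //; exists m; first by case: mCD.
  by apply/rowP => j; rewrite !mxE; field.
have Lc' : L (c' - m).
  rewrite (_ : c' - m = - (c - m)); first exact: submodN.
  by apply/rowP => j; rewrite !mxE; field.
have Ld : L (d - m).
  split; apply: EK; last by exists m; [case: mCD|exists d; rewrite ?opprB].
  exists m; first by case: mCD.
  by exists d' => //; rewrite mE; apply/rowP => j; rewrite !mxE; field.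
have Ld' : L (d' - m).
  rewrite (_ : d' - m = - (d - m)); first exact: submodN.
  by rewrite mE; apply/rowP => j; rewrite !mxE; field.
have := vC c s (conj cC (LS _ Lc)) Ss; have := vC c' s (conj cC' (LS _ Lc')) Ss.
have := wD d s (conj dD (LS _ Ld)) Ss; have := wD d' s (conj dD' (LS _ Ld')) Ss.
rewrite cE cE' !dotw !dotvBl !dotvDl dotvNl dotvZl => h1 h2 h3 h4.
have : t * dotv x v = 0 by lra.
by move=> /eqP; rewrite mulf_eq0 gt_eqF//= => /eqP.
Qed.

(** A supporting functional, in [T_i], of the differences of points of [C] and [D]
    in [T_i + S] is in the nested normal cone of [C], and its opposite in that
    of [D], as one of the two points may be taken in [S]. Stationarity makes it
    orthogonal to itself. The set of differences is convex because [S - S] is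
    contained in [T_i], so that [T_i + S] is an affine subspace. *)
Lemma Tseq_fixed i : Tseq C D S i.+1 = Tseq C D S i ->
  Tseq C D S i `<=` cone_hull E.
Proof.
move=> Tfix x xT; have Tsub := Tseq_submod C D S i.
have LT := @joint_supporting_sub_Tseq i.
have Torth v : Tseq C D S i v -> orth
    (nested_normal_cone C (Tseq C D S i) S `&`
     set_opp (nested_normal_cone D (Tseq C D S i) S)) v.
  by rewrite -{1}Tfix => -[].
move: (Tseq C D S i) {Tfix} => T in xT Tsub LT Torth *.
have [s0 Ss0] := S0.
have SS s s' : S s -> S s' -> T (s - s').
  by move=> /SCD sCD /SCD sCD'; apply/LT/lineality_subI.
have TSP p : set_add T S p <-> T (p - s0).
  split=> [[u uT [s Ss <-]]|pT]; last by exists (p - s0) => //; exists s0; rewrite ?subrK.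
  by rewrite -addrA; apply: submodD => //; apply: SS.
have slice_convex A : convex_set A -> convex_set (A `&` set_add T S).
  move=> Aconv p q t /set_mem[pA /TSP pT] /set_mem[qA /TSP qT].
  apply/mem_set; split; first by apply/set_mem/Aconv; apply/mem_set.
  apply/TSP; have : T (t%:num *: (p - s0) + (1 - t%:num) *: (q - s0)).
    by apply: submodD => //; apply: submodZ.
  by congr (T _); apply/rowP => j; rewrite !mxE /unstable.onem; ring.
pose ET := set_sub (C `&` set_add T S) (D `&` set_add T S).
have ETconv : convex_set ET by apply: convex_set_sub; apply: slice_convex.
have STS s : S s -> set_add T S s by move=> Ss; apply/TSP/SS.
have ET0 : ET 0.
  have [s0C s0D] := SCD Ss0.
  by exists s0; [|exists s0; rewrite ?subrr]; split=> //; apply: STS.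
have ET_T e : ET e -> T e.
  move=> [c [_ /TSP cT] [d [_ /TSP dT] <-]].
  rewrite (_ : c - d = (c - s0) - (d - s0)); first exact: submodB.
  by rewrite opprB addrA subrK.
pose K := cone_hull ET.
have Kcone : convex_cone K by apply: cone_hull_cone.
suff [t t0 [c [cC _] [d [dD _] cd]]] : K x.
  by exists t => //; exists c => //; exists d.
apply: contrapT => xK.
have KT : K `<=` T.
  move=> k [t t0 /ET_T tkT]; rewrite -[k](@scalerK _ _ t) ?gt_eqF//.
  exact: submodZ.
have [v [v0 vT vK]] := cone_support_in Tsub Kcone KT xT xK.
have vE e : ET e -> dotv e v <= 0.
  by move=> eE; apply: vK; exists 1; rewrite ?scale1r.
apply/v0/dotvv_eq0/(Torth v vT); split.
  split=> // c s cC Ss; apply: vE; exists c => //; exists s => //.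
  by split; [case: (SCD Ss)|apply: STS].
exists (- v); last exact: opprK.
split; first exact: submodN.
move=> d s dD Ss; rewrite dotvC dotvNl dotvC -dotvNl opprB.
apply: vE; exists s; last by exists d.
by split; [case: (SCD Ss)|apply: STS].
Qed.

Lemma Tseq_fixed_joint i : Tseq C D S i.+1 = Tseq C D S i ->
  Tseq C D S i = joint_supporting_subspace C D.
Proof.
move=> Tfix; rewrite /joint_supporting_subspace span_face_origin//.
apply/seteqP; split=> [x xT|]; last exact: joint_supporting_sub_Tseq.
by split; apply: Tseq_fixed Tfix _ _ => //; apply: submodN (Tseq_submod _ _ _ _) _.
Qed.
End Fixed.
End Tseq.

Theorem theorem7p1 (R : realType) (n : nat) (C D S : set 'rV[R]_n) :
  convex_set C -> convex_set D -> S !=set0 -> S `<=` C `&` D ->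
  exists l : nat,
    [/\ Tseq C D S l.+1 = Tseq C D S l,
        forall k : nat, (k < l)%N -> Tseq C D S k.+1 <> Tseq C D S k,
        Tseq C D S l = joint_supporting_subspace C D
      & (l <= n)%N].
Proof.
move=> Cconv Dconv S0 SCD.
pose stable k := `[< Tseq C D S k.+1 = Tseq C D S k >].
have stableN m : (forall k, (k < m)%N -> ~~ stable k) -> (m <= n)%N.
  move=> neq; have [|A _] := @Tseq_rank _ _ C D S m.
    by move=> k /neq /asboolPn.
  by apply: leq_trans; rewrite leq_addl.
have ex_stable : exists k, stable k.
  apply: contrapT => /forallNP no; suff : (n.+1 <= n)%N by rewrite ltnn.
  by apply: stableN => k _; apply/negP/no.
case: (ex_minnP ex_stable) => l /asboolP lfix lmin.
have lneq k : (k < l)%N -> ~~ stable k.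
  by move=> kl; apply: contraL kl => /lmin; rewrite -leqNgt.
exists l; split=> //; first by move=> k /lneq /asboolPn.
  exact: Tseq_fixed_joint.
exact: stableN.
Qed.
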